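(* Let $G=(V,E,m,\mu)$ be an unweighted normalized graph satisfying the $\mathrm{CD}(0,\infty)$ condition and $\inf_{x\in V}\mathrm{d}_x\geq 2$. If $\mathrm{Gir}(x_0)\geq 5$ for some $x_0\in V$, then the graph $(V,E)$ is (isomorphic to) either the infinite line $P_{\mathbb{Z}}$ or a cycle graph $C_n$ for some $n\geq 5$.
   Context: All graphs $(V,E)$ are undirected, connected, locally finite and simple (finite or infinite, with more than one vertex). Write $x\sim y$ if $\{x,y\}\in E$, and let $\mathrm{d}_x$ be the number of neighbors of $x$. An unweighted normalized graph is a graph $(V,E)$ with edge weights $\mu_{xy}=1$ for all $\{x,y\}\in E$ and vertex weights $m_x=\sum_{y\sim x}\mu_{xy}=\mathrm{d}_x$. For $f,g:V\to\mathbb{R}$: $\Delta f(x)=\frac{1}{m_x}\sum_{y\sim x}\mu_{xy}(f(y)-f(x))$, $\Gamma(f,g)=\frac12(\Delta(fg)-f\Delta g-g\Delta f)$, $\Gamma(f)=\Gamma(f,f)$, $\Gamma_2(f)=\frac12\Delta\Gamma(f)-\Gamma(f,\Delta f)$. The graph satisfies $\mathrm{CD}(0,\infty)$ if $\Gamma_2(f)(x)\geq 0$ for all $f:V\to\mathbb{R}$ and all $x\in V$. A cycle of length $k>2$ is a walk $x_0\sim x_1\sim\cdots\sim x_k$ with $x_0=x_k$ and $x_0,\dots,x_{k-1}$ pairwise distinct. The girth $\mathrm{Gir}(x)$ of a vertex $x$ is the minimal length of cycles passing through $x$ ($\infty$ if there is none). $P_{\mathbb{Z}}$ is the graph on $\mathbb{Z}$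 with $i\sim i+1$ for all $i\in\mathbb{Z}$; $C_n$ is the cycle graph with $n$ vertices. *)

(* Defs.v *)
From HB Require Import structures.
From mathcomp Require Import all_boot all_order all_algebra.
From mathcomp Require Import finmap.
From mathcomp Require Import boolp classical_sets reals constructive_ereal ereal.

Set Implicit Arguments.
Unset Strict Implicit.
Unset Printing Implicit Defensive.

Import Order.TTheory GRing.Theory Num.Theory.

Local Open Scope classical_set_scope.
Local Open Scope ring_scope.

(* Adjacency [x ~ y] is [y \in nbr x]; local finiteness is built into the      *)
(* type of [nbr].                                                             *)
Record lfgraph (V : choiceType) := LFGraph {
  nbr : V -> {fset V};
  nbr_sym : forall x y, (y \in nbr x) = (x \in nbr y);
  nbr_irr : forall x, x \notin nbr x;
  nbr_connected : forall x y : V,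
    exists2 p : seq V, path (fun u v => v \in nbr u) x p & last x p = y;
  nbr_nontrivial : exists x y : V, x != y
}.

Definition adj (V : choiceType) (G : lfgraph V) : rel V :=
  fun x y => y \in nbr G x.

Definition deg (V : choiceType) (G : lfgraph V) (x : V) : nat := #|` nbr G x|.

(* Only the values of [mu] on edges are ever used. *)
Record wgraph (R : realType) (V : choiceType) := WGraph {
  wg_graph :> lfgraph V;
  mu : V -> V -> R;
  mass : V -> R;
  mu_sym : forall x y, adj wg_graph x y -> mu x y = mu y x;
  mu_gt0 : forall x y, adj wg_graph x y -> 0 < mu x y;
  mass_gt0 : forall x, 0 < mass x
}.

Definition unweighted_normalized (R : realType) (V : choiceType)
    (G : wgraph R V) : Prop :=
  (forall x y, adj G x y -> mu G x y = 1) /\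
  (forall x, mass G x = \sum_(y <- nbr G x) mu G x y).

Section CurvatureDimension.
Variables (R : realType) (V : choiceType) (G : wgraph R V).
Implicit Types f g : V -> R.

Definition Delta f : V -> R := fun x =>
  (mass G x)^-1 * \sum_(y <- nbr G x) mu G x y * (f y - f x).

Definition Gamma f g : V -> R := fun x =>
  2^-1 * (Delta (fun y => f y * g y) x - f x * Delta g x - g x * Delta f x).

Definition Gamma2 f : V -> R := fun x =>
  2^-1 * Delta (Gamma f f) x - Gamma f (Delta f) x.

Definition CD0oo : Prop := forall f x, 0 <= Gamma2 f x.

End CurvatureDimension.

(* The list [c = [:: x_0; ...; x_(k-1)]] encodes the cycle                    *)
(* [x_0 ~ x_1 ~ ... ~ x_k = x_0] of length [k = size c].                      *)
Definition is_cycle (V : choiceType) (G : lfgraph V) (c : seq V) : Prop :=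
  (2 < size c)%N /\ ucycle (adj G) c.

(* The infimum of the empty set is [+oo]. *)
Definition girth (R : realType) (V : choiceType) (G : lfgraph V) (x : V) :
    \bar R :=
  ereal_inf [set ((size c)%:R)%:E | c in [set c | is_cycle G c /\ x \in c]].

Definition graph_iso (V W : Type) (e : rel V) (e' : rel W) : Prop :=
  exists2 f : V -> W, bijective f & forall x y, e x y = e' (f x) (f y).

Definition line_adj : rel int := fun i j => (j == i + 1) || (i == j + 1).

(* This is the cycle graph for [3 <= n]. *)
Definition cycle_adj (n : nat) : rel 'I_n :=
  fun i j => (j == i.+1 %[mod n]) || (i == j.+1 %[mod n]).

(* Main.v *)
Require Import Defs.
From HB Require Import structures.
From mathcomp Require Import all_boot all_order all_algebra.
From mathcomp Require Import finmap zify ring lra.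
From mathcomp Require Import boolp classical_sets reals constructive_ereal ereal.

Set Implicit Arguments.
Unset Strict Implicit.
Unset Printing Implicit Defensive.

Import Order.TTheory GRing.Theory Num.Theory.

Local Open Scope classical_set_scope.
Local Open Scope ring_scope.

(** The curvature at a vertex [x] is a quadratic form in the values of [f] on the
    ball of radius 2.  If [f x = 0], a vertex [z] of the sphere of radius 2 only
    enters through the squares [(f z - 2 * f y) ^+ 2] over its neighbours [y] in
    the sphere of radius 1 ([Gamma2E]).  When no 3- or 4-cycle passes through
    [x], such a [z] has a single neighbour in the sphere of radius 1, so all
    these squares vanish for the choice [f z = 2 * f y], and the curvature
    inequality becomes, for arbitrary values [a y] on the neighbours of [x],

      [0 <= \sum_y (2 / d_y - 1) * a y ^+ 2 + (\sum_y a y) ^+ 2 / d_x]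

    ([Gamma2_doubling_ext]).  Taking [a] equal to [1] and [-1] on two neighbours
    and [0] on the others kills the last term, and as all degrees are at least 2
    the remaining coefficients are nonpositive; hence they are zero and every
    neighbour of [x] has degree 2 ([CD0oo_deg_nbr]).

    A cycle through a neighbour [y] of degree 2 has to use both edges at [y], so
    it also passes through [x]: no 3- or 4-cycle passes through [y]
    ([short_cycle_free_nbr]).  The two facts propagate along paths, so by
    connectedness the whole graph is 2-regular without 3- and 4-cycles
    ([short_cycle_free_two_regular]).

    Finally a connected 2-regular graph is covered by the integer line: walk
    forever in both directions without turning back ([two_regular_line_cover]).
    The walk is either injective, and the graph is the line, or periodic with
    some minimal period [n], and the graph is the cycle on [n] vertices
    ([two_regular_line_or_cycle]); [n = 3] and [n = 4] are excluded. *)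

(** * Short cycles *)

Section ShortCycles.
Variables (V : choiceType) (G : lfgraph V).

Lemma adj_sym : symmetric (adj G).
Proof. by move=> x y; rewrite /adj nbr_sym. Qed.

Lemma adj_neq x y : adj G x y -> x != y.
Proof.
by apply: contraTneq => ->; rewrite /adj (negbTE (nbr_irr G y)).
Qed.

Lemma deg2_other_nbr u v : deg G v = 2%N -> adj G v u ->
  exists2 w, w != u & nbr G v = [fset u; w]%fset.
Proof.
move=> dv vu; have : #|` (nbr G v `\ u)%fset| = 1%N.
  have /= := cardfsD1 u (nbr G v).
  by rewrite (vu : u \in nbr G v) -/(deg G v) dv => -[].
move/eqP/cardfs1P => [w ew]; exists w.
  by have := fset11 w; rewrite -ew !inE => /andP[].
by rewrite -ew fsetD1K.
Qed.

(** No cycle of length 3 or 4 passes through [x], spelled out on adjacencies: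
    neighbours of [x] are pairwise non-adjacent, and a vertex at distance 2 has a
    single common neighbour with [x]. *)
Definition short_cycle_free x :=
  (forall y z, adj G x y -> adj G x z -> ~~ adj G y z) /\
  (forall y z w, adj G x y -> adj G x z -> adj G y w -> adj G z w ->
     w != x -> y = z).

Lemma girth_size (R : realType) x c :
  is_cycle G c -> x \in c -> (girth R G x <= (size c)%:R%:E)%E.
Proof. by move=> hc xc; apply: ereal_inf_lbound; exists c. Qed.

Lemma girth5_short_cycle_free (R : realType) x :
  (5%:R%:E <= girth R G x)%E -> short_cycle_free x.
Proof.
move=> h5.
have noc c : (size c < 5)%N -> x \in c -> ~ is_cycle G c.
  move=> sc xc hc; have := le_trans h5 (girth_size R hc xc).
  by rewrite lee_fin ler_nat leqNgt sc.
split=> [y z xy xz|y z w xy xz yw zw wx].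
  apply/negP => yz; apply: (noc [:: x; y; z]) => //; first exact: mem_head.
  split=> //; apply/andP; split.
    by rewrite /= xy yz adj_sym xz.
  by rewrite /= !inE !negb_or (adj_neq xy) (adj_neq xz) (adj_neq yz).
apply/eqP/negPn/negP => yz.
apply: (noc [:: x; y; w; z]) => //; first exact: mem_head.
split=> //; apply/andP; split.
  by rewrite /= xy yw (adj_sym w) zw adj_sym xz.
rewrite /= !inE !negb_or (adj_neq xy) (adj_neq xz) (adj_neq yw) yz.
by rewrite eq_sym wx eq_sym (adj_neq zw).
Qed.

(** A short cycle through [y] uses both of its edges, hence passes through [x]. *)
Lemma short_cycle_free_nbr x y :
  short_cycle_free x -> adj G x y -> deg G y = 2%N -> short_cycle_free y.
Proof.
move=> [tri sq] xy dy.
have [|z zx ny] := deg2_other_nbr (u := x) dy; first by rewrite adj_sym.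
have yz : adj G y z by rewrite /adj ny !inE eqxx orbT.
have zy : adj G z y by rewrite adj_sym.
have adjy w : adj G y w -> w = x \/ w = z.
  by rewrite /adj ny !inE => /orP[]/eqP; [left|right].
have nxz : ~~ adj G x z by apply/negP => xz; have := tri _ _ xy xz; rewrite yz.
(* [a] and [b] range over the two neighbours [x] and [z] of [y] *)
split=> [a b /adjy[]-> /adjy[]->|a b w /adjy[]-> /adjy[]-> // aw bw wy].
- by rewrite /adj nbr_irr.
- by [].
- by rewrite adj_sym.
- by rewrite /adj nbr_irr.
- have := sq y w z xy aw yz _ zx; rewrite adj_sym bw => /(_ isT) e.
  by rewrite -e eqxx in wy.
- have := sq y w z xy bw yz _ zx; rewrite adj_sym aw => /(_ isT) e.
  by rewrite -e eqxx in wy.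
Qed.

End ShortCycles.

(** * Curvature at a vertex without short cycles *)

Section Curvature.
Variables (R : realType) (V : choiceType) (G : wgraph R V).
Hypothesis hG : unweighted_normalized G.

Lemma mass_deg x : mass G x = (deg G x)%:R.
Proof.
have [h1 ->] := hG; rewrite big_seq (eq_bigr (fun=> 1)) => [|y]; last exact: h1.
by rewrite -big_seq big_const_seq count_predT iter_addr_0.
Qed.

Lemma DeltaE (f : V -> R) x :
  Delta G f x = (deg G x)%:R^-1 * \sum_(y <- nbr G x) (f y - f x).
Proof.
rewrite /Delta mass_deg big_seq [in RHS]big_seq; congr (_ * _).
by apply: eq_bigr => y hy; rewrite (hG.1 _ _ hy) mul1r.
Qed.

Lemma deg_gt0 x : 0 < (deg G x)%:R :> R.
Proof. by rewrite -mass_deg mass_gt0. Qed.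

Lemma sum_nbr_const x (c : R) : \sum_(y <- nbr G x) c = (deg G x)%:R * c.
Proof. by rewrite big_const_seq count_predT iter_addr_0 mulr_natl. Qed.

Lemma GammaE (f g : V -> R) x :
  Gamma G f g x = (2 * (deg G x)%:R)^-1 *
                  \sum_(y <- nbr G x) (f y - f x) * (g y - g x).
Proof.
rewrite /Gamma !DeltaE invfM -mulrA; congr (_ * _).
rewrite mulrCA (mulrCA (g x)) -!mulrBr; congr (_ * _).
rewrite !mulr_sumr -!sumrB; apply: eq_bigr => y _; ring.
Qed.

(** The Bochner formula at a zero of [f], in sum-of-squares form: the terms of the
    ball of radius 2 are collected, through the identity
    [(s - t) ^+ 2 - 2 * t * (s - t) = (s - 2 * t) ^+ 2 - t ^+ 2], so that
    the values at distance 2 only occur inside squares. *)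
Lemma Gamma2E (f : V -> R) x : f x = 0 ->
  2 * (deg G x)%:R * Gamma2 G f x =
    \sum_(y <- nbr G x) ((2 * (deg G y)%:R)^-1 *
        (\sum_(z <- nbr G y) (f z - 2 * f y) ^+ 2) - f y ^+ 2)
    + (deg G x)%:R^-1 * (\sum_(y <- nbr G x) f y) ^+ 2.
Proof.
move=> fx0; have d0 := lt0r_neq0 (deg_gt0 x).
(* the contribution of a neighbour [y], by the identity above *)
have local y : Gamma G f f y - f y * Delta G f y =
    (2 * (deg G y)%:R)^-1 * (\sum_(z <- nbr G y) (f z - 2 * f y) ^+ 2)
    - 2^-1 * f y ^+ 2.
  have dy0 := lt0r_neq0 (deg_gt0 y).
  have -> : 2^-1 * f y ^+ 2 =
      (2 * (deg G y)%:R)^-1 * \sum_(z <- nbr G y) f y ^+ 2.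
    by rewrite sum_nbr_const; field.
  have -> : f y * Delta G f y = (2 * (deg G y)%:R)^-1 *
      \sum_(z <- nbr G y) 2 * f y * (f z - f y).
    by rewrite DeltaE -mulr_sumr; field.
  rewrite GammaE -!mulrBr -!sumrB; congr (_ * _).
  by apply: eq_bigr => z _; ring.
have Gx : (deg G x)%:R * Gamma G f f x = 2^-1 * \sum_(y <- nbr G x) f y ^+ 2.
  rewrite GammaE (eq_bigr (fun y => f y ^+ 2)) => [|y _]; first by field.
  by rewrite fx0 !subr0.
have Dx : Delta G f x = (deg G x)%:R^-1 * \sum_(y <- nbr G x) f y.
  by rewrite DeltaE; under eq_bigr do rewrite fx0 subr0.
transitivity (\sum_(y <- nbr G x) (Gamma G f f y - f y * Delta G f y)
   - (deg G x)%:R * Gamma G f f x + Delta G f x * \sum_(y <- nbr G x) f y).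
  rewrite /Gamma2 (DeltaE (Gamma G f f)) (GammaE f (Delta G f)).
  rewrite sumrB sum_nbr_const.
  have -> : \sum_(y <- nbr G x) (f y - f x) * (Delta G f y - Delta G f x) =
      \sum_(y <- nbr G x) f y * Delta G f y
      - Delta G f x * \sum_(y <- nbr G x) f y.
    rewrite mulr_sumr -sumrB; apply: eq_bigr => y _; rewrite fx0; ring.
  by rewrite sumrB; field.
rewrite Gx Dx (eq_bigr _ (fun y _ => local y)) !sumrB -mulr_sumr.
by field.
Qed.

(** The extension of [a], given on the neighbours of [x], that makes every square
    in [Gamma2E] vanish.  The sum over common neighbours selects the value at
    the unique neighbour of [x] leading to [v]. *)
Definition doubling_ext x (a : V -> R) : V -> R := fun v =>
  if v == x then 0 else if adj G x v then a v
  else 2 * \sum_(y <- nbr G x | adj G y v) a y.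

Lemma doubling_ext_center x a : doubling_ext x a x = 0.
Proof. by rewrite /doubling_ext eqxx. Qed.

Lemma doubling_ext_nbr x a y : adj G x y -> doubling_ext x a y = a y.
Proof.
by move=> xy; rewrite /doubling_ext eq_sym (negbTE (adj_neq xy)) xy.
Qed.

Lemma doubling_ext_sphere2 x a y z : short_cycle_free G x ->
  adj G x y -> adj G y z -> z != x -> doubling_ext x a z = 2 * a y.
Proof.
move=> [tri sq] xy yz zx; rewrite /doubling_ext (negbTE zx).
have /negbTE -> : ~~ adj G x z.
  by apply/negP => xz; have := tri _ _ xy xz; rewrite yz.
congr (2 * _); rewrite big_mkcond (bigD1_seq y) ?fset_uniq //= yz.
rewrite big_seq_cond big1 ?addr0 // => w /andP[xw wy].
by case: ifP wy => // wz; rewrite (sq w y z xw xy wz yz zx) eqxx.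
Qed.

(** Among the neighbours of a neighbour [y] of [x], only [x] itself leaves a
    possibly nonzero square, namely [4 * a y ^+ 2]. *)
Lemma Gamma2_doubling_ext x a : short_cycle_free G x ->
  2 * (deg G x)%:R * Gamma2 G (doubling_ext x a) x =
    \sum_(y <- nbr G x) (2 / (deg G y)%:R - 1) * a y ^+ 2
    + (deg G x)%:R^-1 * (\sum_(y <- nbr G x) a y) ^+ 2.
Proof.
move=> scf; rewrite Gamma2E ?doubling_ext_center //.
congr (_ + _ * _ ^+ 2); rewrite big_seq [RHS]big_seq; apply: eq_bigr => y xy;
  rewrite (doubling_ext_nbr _ xy) //.
have yx : x \in nbr G y by rewrite nbr_sym.
rewrite (bigD1_seq x) ?fset_uniq //= doubling_ext_center.
rewrite big_seq_cond big1 => [|z /andP[yz zx]]; last first.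
  by rewrite (doubling_ext_sphere2 _ scf xy yz zx) subrr expr0n.
by have dy := lt0r_neq0 (deg_gt0 y); field.
Qed.

(** Tested against [a = 1] at [y] and [a = -1] at a second neighbour [z], the
    curvature inequality reads [0 <= (2 / d_y - 1) + (2 / d_z - 1)], a sum of
    nonpositive terms. *)
Lemma CD0oo_deg_nbr x : CD0oo G -> (forall y, 2 <= deg G y)%N ->
  short_cycle_free G x -> forall y, adj G x y -> deg G y = 2%N.
Proof.
move=> cd d2 scf y xy.
have [z xz zy] : exists2 z, adj G x z & z != y.
  have : (0 < #|` (nbr G x `\ y)%fset|)%N.
    have := cardfsD1 y (nbr G x); have := d2 x.
    by rewrite -/(deg G x) (xy : y \in nbr G x); lia.
  by rewrite cardfs_gt0 => /fset0Pn[z]; rewrite !inE => /andP[zy xz]; exists z.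
have yz : y != z by rewrite eq_sym.
pose a v : R := if v == y then 1 else if v == z then -1 else 0.
have ay : a y = 1 by rewrite /a eqxx.
have az : a z = -1 by rewrite /a (negbTE zy) eqxx.
have two (F : V -> R) : (forall v, v != y -> v != z -> F v = 0) ->
    \sum_(v <- nbr G x) F v = F y + F z.
  move=> F0; rewrite (bigD1_seq y) ?fset_uniq //= big_mkcond.
  rewrite (bigD1_seq z) ?fset_uniq //= zy big1 ?addr0 // => v vz.
  by case: ifP => // vy; exact: F0.
have a0 v : v != y -> v != z -> a v = 0 by rewrite /a => /negbTE-> /negbTE->.
have := Gamma2_doubling_ext a scf.
rewrite !two //; last by move=> v vy vz; rewrite a0 // expr0n mulr0.
rewrite ay az subrr expr0n mulr0 addr0 sqrrN expr1n !mulr1.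
have : 0 <= 2 * (deg G x)%:R * Gamma2 G (doubling_ext x a) x.
  by rewrite !mulr_ge0 // ?ler0n //; exact: cd.
move=> /[swap] -> h.
have le1 v : 2 / (deg G v)%:R <= 1 :> R.
  by rewrite ler_pdivrMr ?deg_gt0 // mul1r ler_nat.
have : 1 <= 2 / (deg G y)%:R :> R by have := le1 z; lra.
rewrite ler_pdivlMr ?deg_gt0 // mul1r ler_nat => dy.
by apply/eqP; rewrite eqn_leq dy d2.
Qed.

(** Connectedness spreads the local condition from [x0] to the whole graph; each
    vertex then has degree 2 as a neighbour of any of its neighbours. *)
Lemma short_cycle_free_two_regular x0 : CD0oo G ->
  (forall y, 2 <= deg G y)%N -> short_cycle_free G x0 ->
  forall x, deg G x = 2%N /\ short_cycle_free G x.
Proof.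
move=> cd d2.
have step x y : short_cycle_free G x -> adj G x y ->
    deg G y = 2%N /\ short_cycle_free G y.
  move=> sx xy; have dy := CD0oo_deg_nbr cd d2 sx xy.
  by split=> //; exact: short_cycle_free_nbr sx xy dy.
have allscf x : short_cycle_free G x0 -> short_cycle_free G x.
  have [p] := nbr_connected G x0 x.
  elim: p x0 => [|y p IH] u /=; first by move=> _ <-.
  by move=> /andP[uy /IH{}IH] /IH{}IH su; apply: IH; exact: (step u y su uy).2.
move=> s0 x; split; last exact: allscf.
have : (0 < deg G x)%N by have := d2 x; lia.
rewrite cardfs_gt0 => /fset0Pn[y xy].
(* [x] has degree 2 because it is a neighbour of the short-cycle-free [y] *)
apply: (step y x (allscf y s0) _).1; by rewrite adj_sym.
Qed.
End Curvature.

(** * Connected 2-regular graphs *)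

Section TwoRegular.
Variables (V : choiceType) (G : lfgraph V).

(** [h] is a graph covering of [G] by the line: around each integer it is a
    bijection between neighbours. *)
Definition line_cover (h : int -> V) := forall i,
  nbr G (h i) = [fset h (i - 1); h (i + 1)%R]%fset /\ h (i - 1) != h (i + 1).

(** Starting from an edge [u v], walk in each direction by always leaving a vertex
    through the edge not just used.  The walk from [(u, v)] gives [h 0 = u],
    [h 1 = v] and onwards; the walk from [(v, u)] starts with [h 1], [h 0] and
    gives the negative side from its index 2 on. *)
Lemma two_regular_line_cover :
  (forall x, deg G x = 2%N) -> exists h, line_cover h.
Proof.
move=> d2; have [u [v0 _]] := nbr_nontrivial G.
have [v uv] : exists v, adj G u v.
  have : (0 < #|` nbr G u|)%N by rewrite -/(deg G u) d2.
  by rewrite cardfs_gt0 => /fset0Pn.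
have [next nextP] : exists next : V -> V -> V, forall a b, adj G a b ->
    next a b != a /\ nbr G b = [fset a; next a b]%fset.
  have /choice[nx nxP] : forall p : V * V, exists w, adj G p.1 p.2 ->
      w != p.1 /\ nbr G p.2 = [fset p.1; w]%fset.
    move=> [a b] /=; have [ab|] := boolP (adj G a b); last by exists a.
    have [|w wa nb] := deg2_other_nbr (u := a) (d2 b); first by rewrite adj_sym.
    by exists w.
  by exists (fun a b => nx (a, b)) => a b /(nxP (a, b)).
pose walk a b n := (iter n (fun p => (p.2, next p.1 p.2)) (a, b)).1.
have walkP a b n : adj G a b ->
    nbr G (walk a b n.+1) = [fset walk a b n; walk a b n.+2]%fset
    /\ walk a b n != walk a b n.+2.
  move=> ab; rewrite /walk /=; set p := iter n _ _.
  have : adj G p.1 p.2.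
    rewrite {}/p; elim: n => //= n IH.
    by have [_] := nextP _ _ IH; rewrite /adj => ->; rewrite !inE eqxx orbT.
  by move=> /nextP[nx ->]; rewrite eq_sym.
have vu : adj G v u by rewrite adj_sym.
exists (fun i =>
  match i with Posz n => walk u v n | Negz n => walk v u n.+2 end).
case=> [[|n]|n].
- have [nb ne] := walkP v u 0%N vu; split.
    by rewrite -[LHS]/(nbr G (walk v u 1%N)) nb fsetUC.
  by rewrite eq_sym.
- have -> : Posz n.+1 - 1 = Posz n by lia.
  have -> : Posz n.+1 + 1 = Posz n.+2 by lia.
  exact: walkP.
- have -> : Negz n - 1 = Negz n.+1 by lia.
  have [nb ne] := walkP v u n.+1 vu.
  case: n nb ne => [|n] nb ne.
    by rewrite nb fsetUC eq_sym.
  have -> : Negz n.+1 + 1 = Negz n by lia.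
  by rewrite nb fsetUC eq_sym.
Qed.

Section Cover.
Variable h : int -> V.
Hypothesis hP : line_cover h.

Lemma line_cover_adj i j :
  adj G (h i) (h j) = (h j == h (i - 1)) || (h j == h (i + 1)).
Proof. by rewrite /adj (hP i).1 !inE. Qed.

Lemma line_cover_surj x : exists i, h i = x.
Proof.
have [p] := nbr_connected G (h 0) x.
elim: p 0 => [|y p IH] i /=; first by move=> _ <-; exists i.
move=> /andP[]; rewrite -/(adj G (h i) y) /adj (hP i).1 !inE.
by move=> /orP[]/eqP -> /IH.
Qed.

Lemma line_cover_inj_iso : injective h -> graph_iso (adj G) line_adj.
Proof.
move=> hI; have [g gK] := choice line_cover_surj.
have hK : cancel h g by move=> i; apply: hI; rewrite gK.
exists g; first by exists h.
move=> x y; rewrite -{1}[x]gK -{1}[y]gK line_cover_adj !(inj_eq hI) /line_adj.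
by lia.
Qed.

(** Let [n] be the least positive distance between two integers with the same image.
    If [h i = h (i + n)], then [h (i + 1)], a neighbour of [h (i + n)], is
    [h (i + n + 1)] or [h (i + n - 1)]; the second would give a coincidence at
    the positive distance [n - 2 < n].  So the coincidence propagates and [h] is
    [n]-periodic. *)
Lemma line_cover_min_period : ~ injective h ->
  exists n : nat, (2 < n)%N /\ forall i j, h i = h j <-> (n %| i - j)%Z.
Proof.
move=> nI.
pose P n := (0 < n)%N && `[< exists i, h i = h (i + Posz n) >].
have exP : exists n, P n.
  apply: contrapT => nP; apply: nI => i j hij; apply: contrapT => ij.
  apply: nP; have [lij|lij] : i < j \/ j < i by lia.
    exists `|j - i|%N; apply/andP; split; first by lia.
    by apply/asboolP; exists i; rewrite hij; congr h; lia.
  exists `|i - j|%N; apply/andP; split; first by lia.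
  by apply/asboolP; exists j; rewrite -hij; congr h; lia.
case: (ex_minnP exP) => n /andP[n0 /asboolP[i0 hi0]] nmin.
have minn i k : (0 < k < n)%N -> h i <> h (i + Posz k).
  move=> /andP[k0 kn] hik; have : (n <= k)%N.
    by apply: nmin; rewrite /P k0; apply/asboolP; exists i.
  by lia.
(* [h i != h (i + 1)] as adjacent vertices differ, and [h i != h (i + 2)] as the
   covering does not turn back *)
have n2 : (2 < n)%N.
  case: n {nmin minn} n0 hi0 => [|[|[|n]]] // _ hi0.
    have : adj G (h i0) (h (i0 + 1)) by rewrite line_cover_adj eqxx orbT.
    by rewrite -[i0 + 1]/(i0 + Posz 1) -hi0 /adj (negbTE (nbr_irr G _)).
  have := (hP (i0 + 1)).2; rewrite addrK.
  have -> : i0 + 1 + 1 = i0 + Posz 2 by lia.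
  by rewrite -hi0 eqxx.
have up i : h i = h (i + Posz n) -> h (i + 1) = h (i + 1 + Posz n).
  move=> hi; have : adj G (h (i + Posz n)) (h (i + 1)).
    by rewrite -hi line_cover_adj eqxx orbT.
  rewrite line_cover_adj => /orP[]/eqP e; last by rewrite e; congr h; lia.
  case: (@minn (i + 1) (n - 2)%N); first by lia.
  by rewrite e; congr h; lia.
have down i : h i = h (i + Posz n) -> h (i - 1) = h (i - 1 + Posz n).
  move=> hi; have : adj G (h i) (h (i - 1 + Posz n)).
    by rewrite hi line_cover_adj; apply/orP; left; apply/eqP; congr h; lia.
  rewrite line_cover_adj => /orP[]/eqP e; first by rewrite e.
  case: (@minn (i + 1) (n - 2)%N); first by lia.
  by rewrite -e; congr h; lia.
have per i : h i = h (i + Posz n).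
  have -> : i = i0 + (i - i0) by lia.
  elim/int_rec: (i - i0) => [|m|m]; first by rewrite addr0.
    by move/up; congr (h _ = h _); lia.
  by move/down; congr (h _ = h _); lia.
have perM i (q : int) : h (i + q * Posz n) = h i.
  elim/int_rec: q => [|m|m]; first by rewrite mul0r addr0.
    by move=> <-; rewrite [RHS]per; congr h; lia.
  by move=> <-; rewrite [LHS]per; congr h; lia.
exists n; split=> // i j; split=> [hij|/dvdzP[q e]]; last first.
  by have -> : i = j + q * Posz n by lia.
apply/dvdz_mod0P; apply: contrapT => r0.
have rge : 0 <= ((i - j) %% n)%Z by apply: modz_ge0; lia.
have rlt : ((i - j) %% n)%Z < n by apply: ltz_pmod; lia.
apply: (@minn j `|((i - j) %% n)%Z|%N); first by lia.
rewrite -hij -(perM (j + _) ((i - j) %/ n)%Z); congr h.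
by have := divz_eq (i - j) n; lia.
Qed.

Lemma line_cover_periodic_iso n : (2 < n)%N ->
  (forall i j, h i = h j <-> (n %| i - j)%Z) ->
  graph_iso (adj G) (@cycle_adj n).
Proof.
move=> n2 hE.
have surj x : exists k : 'I_n, h k = x.
  have [i <-] := line_cover_surj x.
  have rge : 0 <= (i %% n)%Z by apply: modz_ge0; lia.
  have rlt : (i %% n)%Z < n by apply: ltz_pmod; lia.
  have kn : (`|(i %% n)%Z| < n)%N by lia.
  exists (Ordinal kn); apply/hE => /=; apply/dvdzP; exists (- (i %/ n)%Z).
  by have := divz_eq i n; lia.
have hmod (i j : nat) : (h i == h j) = (i == j %[mod n]).
  apply/eqP/idP => [/hE|]; first by rewrite -eqz_mod_dvd !modz_nat.
  by move=> e; apply/hE; rewrite -eqz_mod_dvd !modz_nat.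
have [g gK] := choice surj.
have hK : cancel (fun k : 'I_n => h k) g.
  move=> k; apply/val_inj/eqP; have := gK (h k) => /eqP.
  by rewrite hmod !modn_small.
exists g; first by exists (fun k : 'I_n => h k).
move=> x y; rewrite -{1}[x]gK -{1}[y]gK line_cover_adj /cycle_adj orbC.
congr (_ || _); first by rewrite -hmod; congr (h _ == h _); lia.
rewrite -hmod eq_sym.
by apply/eqP/eqP => /hE e; apply/hE; move: e; congr is_true; congr dvdz; lia.
Qed.
End Cover.

Lemma two_regular_line_or_cycle : (forall x, deg G x = 2%N) ->
  graph_iso (adj G) line_adj \/
  exists2 n, (2 < n)%N & graph_iso (adj G) (@cycle_adj n).
Proof.
move=> /two_regular_line_cover[h hP].
have [hI|/(line_cover_min_period hP)[n [n2 hE]]] := pselect (injective h).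
  by left; exact: line_cover_inj_iso hI.
by right; exists n => //; exact: line_cover_periodic_iso hE.
Qed.

Lemma short_cycle_free_cycle_ge5 n : (forall x, short_cycle_free G x) ->
  (2 < n)%N -> graph_iso (adj G) (@cycle_adj n) -> (5 <= n)%N.
Proof.
move=> scf n2 [f [g fK gK] fE]; rewrite leqNgt; apply/negP => n5.
have gE i j : adj G (g i) (g j) = cycle_adj i j by rewrite fE !gK.
have [] : n = 3%N \/ n = 4%N by lia.
  move=> n3; subst n; have [tri _] := scf (g ord0).
  have := tri (g (inord 1)) (g (inord 2)).
  by rewrite !gE /cycle_adj !inordK //= => /(_ isT isT).
move=> n4; subst n; have [_ sq] := scf (g ord0).
have := sq (g (inord 1)) (g (inord 3)) (g (inord 2)).
rewrite !gE /cycle_adj !inordK //= => /(_ isT isT isT isT).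
have ginj := can_inj gK; rewrite (inj_eq ginj) -val_eqE /= !inordK //.
by move=> /(_ isT) /ginj /(congr1 val); rewrite /= !inordK.
Qed.

End TwoRegular.

Theorem theorem1p2 (R : realType) (V : choiceType) (G : wgraph R V)
    (hG : unweighted_normalized G)
    (hCD : CD0oo G)
    (hdeg : 2 <= inf (range (fun x : V => (deg G x)%:R : R)))
    (x0 : V) (hgirth : (5%:R%:E <= girth R G x0)%E) :
  graph_iso (adj G) line_adj \/
  exists2 n : nat, (5 <= n)%N & graph_iso (adj G) (@cycle_adj n).
Proof.
have d2 x : (2 <= deg G x)%N.
  rewrite -(ler_nat R); apply: le_trans hdeg _; apply: ge_inf; last by exists x.
  by exists 0 => _ [y _ <-]; exact: ler0n.
have reg := short_cycle_free_two_regular hG hCD d2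
  (girth5_short_cycle_free hgirth).
have [iso|[n n2 iso]] := two_regular_line_or_cycle (fun x => (reg x).1).
  by left.
right; exists n => //.
exact: short_cycle_free_cycle_ge5 (fun x => (reg x).2) n2 iso.
Qed.
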